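(* For all $M\in\mathbb N$, all $d\in\mathbb Z$ and all $0\le T\le M$, $$\gamma(d,T,M+1)=\gamma(-d,M-T,M+1).$$
   Context: Fix integers $M\ge1$, $q\ge2$. The augmented state set is $\overline S=\{(b_1,\dots,b_M,d;T,t): b_m,d,T\in\mathbb Z,\ 1\le t\le M+1,\ d+T+\sum_{m=1}^M b_m=0\}$, the BDM state set is $S=\{s\in\overline S:0\le T\le M\}$, and $S(T_0,t_0,d_0)=\{s\in S: T=T_0,t=t_0,d=d_0\}$; initial state $s_0=(0,\dots,0,0;0,M+1)$. The BDM is the Markov chain on $S$ with transitions from $s=(b_1,\dots,b_M,d;T,t)$: if $t\le M$ and $b_t>d$, with probability $(q-1)/q$ to $(b_1,\dots,b_{t-1},d,b_{t+1},\dots,b_M,b_t;T,t+1)$ and with probability $1/q$ to $(b_1,\dots,b_M,d;T,t+1)$; if $t\le M$ and $b_t\le d$, with probability 1 to $(b_1,\dots,b_M,d;T,t+1)$; if $t=M+1,T<M$, with probability 1 to $(b_1,\dots,b_M,d-1;T+1,1)$; if $t=M+1,T=M$, with probability 1 to $(b_1+1,\dots,b_M+1,d;0,1)$. Let $\mu_0$ be the point mass at $s_0$, $\mu_{\tau+1}(s')=\sum_s\mu_\tau(s)p(s,s')$, and $\mu_\infty(s)=\limsup_{\tau\to\infty}\mu_\tau(s)$. Define $\gamma(d,T,t)=\sum_{s\in S(T,t,d)}\mu_\infty(s)$. *)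

(* Defs.v *)
From HB Require Import structures.
From mathcomp Require Import all_boot all_order all_algebra.
From mathcomp Require Import all_classical all_reals.
From mathcomp Require Import ereal sequences esum.
Set Implicit Arguments. Unset Strict Implicit. Unset Printing Implicit Defensive.
Import Order.TTheory GRing.Theory Num.Theory.
Local Open Scope ring_scope.

(* A state (b_1..b_M, d; T, t) is encoded as ((b, d), T, t) with
   b : {ffun 'I_M -> int}, where b_m (1-indexed) is b (m-1). *)
Definition bdm_state (M : nat) := ({ffun 'I_M -> int} * int * int * nat)%type.

Section BDM.
Variables (R : realType) (M q : nat).

Definition st_b (s : bdm_state M) : {ffun 'I_M -> int} := s.1.1.1.
Definition st_d (s : bdm_state M) : int := s.1.1.2.
Definition st_T (s : bdm_state M) : int := s.1.2.
Definition st_t (s : bdm_state M) : nat := s.2.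

Definition in_Sbar (s : bdm_state M) : Prop :=
  (1 <= st_t s <= M.+1)%N /\
  st_d s + st_T s + \sum_(m < M) st_b s m = 0.

Definition in_S (s : bdm_state M) : Prop :=
  in_Sbar s /\ 0 <= st_T s <= M%:Z.

Definition S_slice (T0 : int) (t0 : nat) (d0 : int) : set (bdm_state M) :=
  [set s | in_S s /\ st_T s = T0 /\ st_t s = t0 /\ st_d s = d0].

Definition s0 : bdm_state M := ([ffun => 0], 0, 0, M.+1).

(* b_t for 1 <= t <= M, using 1-indexing *)
Definition b_at (b : {ffun 'I_M -> int}) (t : nat) : int :=
  \sum_(m < M | m.+1 == t) b m.

(* outgoing transitions of s, as a list of (target, probability) pairs;
   p(s,s') is the total probability of the entries with target s' *)
Definition step (s : bdm_state M) : seq (bdm_state M * R) :=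
  let: (b, d, T, t) := s in
  if (t <= M)%N then
    if d < b_at b t then
      [:: (([ffun m : 'I_M => if m.+1 == t then d else b m], b_at b t, T, t.+1),
            (q%:R - 1) / q%:R);
          ((b, d, T, t.+1), 1 / q%:R)]
    else [:: ((b, d, T, t.+1), 1)]
  else if T < M%:Z then [:: ((b, d - 1, T + 1, 1%N), 1)]
  else [:: (([ffun m => b m + 1], d, 0, 1%N), 1)].

Definition trans_prob (s s' : bdm_state M) : R :=
  \sum_(x <- step s | x.1 == s') x.2.

Fixpoint mu_list (tau : nat) : seq (bdm_state M * R) :=
  match tau with
  | 0 => [:: (s0, 1)]
  | tau'.+1 => flatten [seq [seq (x.1, p.2 * x.2) | x <- step p.1] | p <- mu_list tau']
  end.

Definition mu (tau : nat) (s : bdm_state M) : R :=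
  \sum_(p <- mu_list tau | p.1 == s) p.2.

Definition mu_inf (s : bdm_state M) : \bar R :=
  limn_esup (fun tau => (mu tau s)%:E).

Definition gamma (d : int) (T : int) (t : nat) : \bar R :=
  \esum_(s in S_slice T t d) mu_inf s.

End BDM.

(* Main.v *)
Require Import Defs.
From HB Require Import structures.
From mathcomp Require Import all_boot all_order all_algebra.
From mathcomp Require Import all_classical all_reals.
From mathcomp Require Import ereal sequences esum.
From mathcomp Require Import zify ring lra.
Set Implicit Arguments. Unset Strict Implicit. Unset Printing Implicit Defensive.
Import Order.TTheory GRing.Theory Num.Theory.
Local Open Scope ring_scope.

(* Line up the batteries and the drain as (b_1, ..., b_(t-1), d, b_t, ..., b_M)
   and let K be the sum over the pairs (a, b) of entries, a before b, of a - b
   if a >= b and of b - a - 1 otherwise.  The measure q^-K is stationary, has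
   finite mass on each slice (T, t), and dominates mu_tau for all tau because it
   dominates the initial point mass.  The ratio u of mu_inf to q^-K is therefore
   bounded, and as a limsup it is subharmonic for the time-reversed chain.
   Around a full cycle of (T, t) the q^-K-integral of u^2 can neither grow nor,
   by periodicity, shrink, so Jensen's inequality is an equality everywhere and
   u is constant along all transitions; since these connect every state to s_0,
   mu_inf = c q^-K.  Finally K is invariant under the bijection
   (b_1, ..., b_M, d; T) -> (-1 - b_M, ..., -1 - b_1, -d; M - T) at t = M + 1. *)

(** * The class of a state *)

(** Since [Negz n] is [-1 - n], this extends the identity of the naturals symmetrically about
    -1/2. *)
Definition cost (k : int) : nat := match k with Posz n => n | Negz n => n end.

Lemma cost_refl (k l : int) : k + l = -1 -> cost k = cost l.
Proof. by case: k => k; case: l => l /=; lia. Qed.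

(** This extra unit, for a pair with its larger entry first, is the source of the factor [r] in
    [wt_lt]. *)
Lemma costS (k l : int) : k + l = 0 -> 0 < k -> cost k = (cost l).+1.
Proof. by case: k => k; case: l => l /=; lia. Qed.

Fixpoint inv_cost (s : seq int) : nat :=
  if s is a :: s' then (\sum_(b <- s') cost (a - b)%R + inv_cost s')%N else 0%N.

Lemma inv_cost_cat (s1 s2 : seq int) :
  inv_cost (s1 ++ s2) =
  (inv_cost s1 + inv_cost s2 + \sum_(a <- s1) \sum_(b <- s2) cost (a - b)%R)%N.
Proof.
elim: s1 => [|a s1 IH] /=; first by rewrite big_nil; lia.
by rewrite IH big_cat big_cons /=; lia.
Qed.

Lemma inv_cost_rcons (s : seq int) (a : int) :
  inv_cost (rcons s a) = (inv_cost s + \sum_(b <- s) cost (b - a)%R)%N.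
Proof.
rewrite -cats1 inv_cost_cat /= big_nil addn0.
by under [in LHS]eq_bigr do rewrite big_seq1; lia.
Qed.

(** Only the mutual cost of the two adjacent entries changes; the additive form avoids subtraction
    in [nat]. *)
Lemma inv_cost_swap (s1 s2 : seq int) (a b : int) :
  (inv_cost (s1 ++ a :: b :: s2) + cost (b - a)%R =
   inv_cost (s1 ++ b :: a :: s2) + cost (a - b)%R)%N.
Proof.
rewrite !inv_cost_cat /= !big_cons.
have -> : (\sum_(c <- s1) \sum_(e <- [:: a, b & s2]) cost (c - e)%R =
           \sum_(c <- s1) \sum_(e <- [:: b, a & s2]) cost (c - e)%R)%N.
  by apply: eq_bigr => c _; rewrite !big_cons; lia.
lia.
Qed.

(** Moving [d] to the front as [d - 1] turns each [b - d] into [d - 1 - b]; the two add up to -1, so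
    [cost_refl] applies. *)
Lemma inv_cost_rotate_down (s : seq int) (d : int) :
  inv_cost (d - 1 :: s) = inv_cost (rcons s d).
Proof.
rewrite inv_cost_rcons /= addnC; congr addn.
by apply: eq_bigr => b _; apply: cost_refl; lia.
Qed.

Lemma inv_cost_map_addr (s : seq int) (c : int) :
  inv_cost [seq b + c | b <- s] = inv_cost s.
Proof.
elim: s => //= a s ->; congr addn; rewrite big_map.
by apply: eq_bigr => b _; congr cost; ring.
Qed.

(** Reflection negates each difference and reversal exchanges the two entries of each pair, which
    restores [a - b]. *)
Lemma inv_cost_rev_map (s : seq int) (c : int) :
  inv_cost (rev [seq c - b | b <- s]) = inv_cost s.
Proof.
elim: s => //= a s IH; rewrite rev_cons inv_cost_rcons IH addnC; congr addn.
rewrite (perm_big [seq c - b | b <- s]) /=; last by rewrite perm_rev.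
by rewrite big_map; apply: eq_bigr => b _; congr cost; ring.
Qed.

(** * Lineups, exchanges and the reflection *)

Section Coordinates.
Variable M : nat.
Implicit Type x : {ffun 'I_M -> int} * int.

(* The battery states listed in order, with the drain inserted just before the
   battery it is about to be compared with. *)
Definition lineup (k : nat) x : seq int :=
  take k (codom x.1) ++ x.2 :: drop k (codom x.1).

(** The exchange is performed whatever the comparison of [x.2] with [x.1 i] says, which makes it an
    involution. *)
Definition xch (i : 'I_M) x : {ffun 'I_M -> int} * int :=
  ([ffun m => if m == i then x.2 else x.1 m], x.1 i).

Lemma xchK (i : 'I_M) : involutive (xch i).
Proof.
move=> [b d]; rewrite /xch /= ffunE eqxx; congr pair; apply/ffunP => m.
by rewrite !ffunE; case: eqP => // ->.
Qed.

Lemma size_codom_ord (f : {ffun 'I_M -> int}) : size (codom f) = M.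
Proof. by rewrite size_codom card_ord. Qed.

Lemma nth_codom_ord (f : {ffun 'I_M -> int}) (i : 'I_M) :
  nth 0 (codom f) i = f i.
Proof. by rewrite codomE (nth_map i) ?size_enum_ord // nth_ord_enum. Qed.

Lemma eq_take_codom (f g : {ffun 'I_M -> int}) (k : nat) :
  (forall m : 'I_M, (m < k)%N -> f m = g m) ->
  take k (codom f) = take k (codom g).
Proof.
move=> fg; apply: (@eq_from_nth _ 0); rewrite !size_take !size_codom_ord // => j.
move=> jk; have [jk' jM] : (j < k)%N /\ (j < M)%N by move: jk; case: (ltnP k M); lia.
by rewrite !nth_take // (nth_codom_ord f (Ordinal jM)) (nth_codom_ord g (Ordinal jM)) fg.
Qed.

Lemma eq_drop_codom (f g : {ffun 'I_M -> int}) (k : nat) :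
  (forall m : 'I_M, (k <= m)%N -> f m = g m) ->
  drop k (codom f) = drop k (codom g).
Proof.
move=> fg; apply: (@eq_from_nth _ 0); rewrite !size_drop !size_codom_ord // => j.
move=> jk; have jM : (k + j < M)%N by lia.
rewrite !nth_drop (nth_codom_ord f (Ordinal jM)) (nth_codom_ord g (Ordinal jM)) fg //=.
by lia.
Qed.

Lemma lineupE (i : 'I_M) x :
  lineup i x = take i (codom x.1) ++ [:: x.2, x.1 i & drop i.+1 (codom x.1)].
Proof.
by rewrite /lineup (drop_nth 0) ?size_codom_ord // nth_codom_ord.
Qed.

Lemma lineupSE (i : 'I_M) x :
  lineup i.+1 x = take i (codom x.1) ++ [:: x.1 i, x.2 & drop i.+1 (codom x.1)].
Proof.
by rewrite /lineup (take_nth 0) ?size_codom_ord // nth_codom_ord cat_rcons.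
Qed.

(** Exchanging the drain with battery [i] acts on the lineup like moving the insertion point past
    that battery. *)
Lemma lineup_xch (i : 'I_M) x : lineup i (xch i x) = lineup i.+1 x.
Proof.
rewrite lineupE lineupSE /= ffunE eqxx.
congr (_ ++ [:: _, _ & _]).
  by apply: eq_take_codom => m mi; rewrite ffunE; case: eqP mi => // ->; rewrite ltnn.
by apply: eq_drop_codom => m mi; rewrite ffunE; case: eqP mi => // ->; rewrite ltnn.
Qed.

Lemma lineup0 x : lineup 0 x = x.2 :: codom x.1.
Proof. by rewrite /lineup take0 drop0. Qed.

Lemma lineupM x : lineup M x = rcons (codom x.1) x.2.
Proof.
by rewrite /lineup take_oversize ?drop_oversize ?size_codom_ord // cats1.
Qed.

Definition refl x : {ffun 'I_M -> int} * int :=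
  ([ffun m => -1 - x.1 (rev_ord m)], - x.2).

Lemma reflK : involutive refl.
Proof.
move=> [b d]; rewrite /refl /= opprK; congr pair; apply/ffunP => m.
by rewrite !ffunE /= rev_ordK; ring.
Qed.

Lemma codom_refl x : codom (refl x).1 = rev [seq -1 - b | b <- codom x.1].
Proof.
have szr : size (rev [seq -1 - b | b <- codom x.1]) = M.
  by rewrite size_rev size_map size_codom_ord.
apply: (@eq_from_nth _ 0); rewrite size_codom_ord ?szr // => j jM.
rewrite nth_rev; last by rewrite size_map size_codom_ord.
rewrite size_map size_codom_ord.
rewrite (nth_codom_ord _ (Ordinal jM)) ffunE.
have jM' : (M - j.+1 < M)%N by lia.
rewrite (nth_map 0) ?size_codom_ord // (nth_codom_ord _ (Ordinal jM')).
by congr (_ - x.1 _); apply: val_inj.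
Qed.

(** Reversal preserves the costs among batteries. Against the drain, [b - d] becomes [d - 1 - b], of
    equal cost by [cost_refl]. *)
Lemma inv_cost_refl x : inv_cost (lineup M (refl x)) = inv_cost (lineup M x).
Proof.
rewrite !lineupM !inv_cost_rcons codom_refl inv_cost_rev_map; congr addn.
rewrite (perm_big [seq -1 - b | b <- codom x.1]) /=; last by rewrite perm_rev.
by rewrite big_map; apply: eq_bigr => b _; apply: cost_refl; ring.
Qed.

End Coordinates.

(** * Summability of the weights *)

Lemma ler_sum_sub (R : numDomainType) (I : eqType) (s1 s2 : seq I) (F : I -> R) :
  uniq s1 -> uniq s2 -> {subset s1 <= s2} -> (forall i, 0 <= F i) ->
  \sum_(i <- s1) F i <= \sum_(i <- s2) F i.
Proof.
move=> u1 u2 s12 F0; rewrite [leRHS](bigID (mem s1)) /= -[X in _ <= X + _]big_filter.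
have p : perm_eq s1 [seq i <- s2 | i \in s1].
  apply: uniq_perm => //; first exact: filter_uniq.
  by move=> i; rewrite mem_filter; case: (boolP (i \in s1)) => //= /s12 ->.
by rewrite (perm_big _ p) lerDl sumr_ge0.
Qed.

(** The functions in [A] take values in a finite list [s]; enlarging [A] to all functions into [s]
    makes the sum factor into [M] sums over [s]. *)
Lemma ler_sum_ffun_prod (R : numFieldType) (M : nat) (F : int -> R) (C : R)
    (A : seq {ffun 'I_M -> int}) :
  (forall k, 0 <= F k) ->
  (forall s, uniq s -> \sum_(k <- s) F k <= C) ->
  uniq A -> \sum_(f <- A) \prod_(i < M) F (f i) <= C ^+ M.
Proof.
move=> F0 FC uA.
pose s := undup (flatten [seq codom f | f : {ffun 'I_M -> int} <- A]).
have sP f i : f \in A -> f i \in s.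
  move=> fA; rewrite mem_undup; apply/flattenP; exists (codom f).
    exact: map_f.
  exact: codom_f.
pose h (g : {ffun 'I_M -> 'I_(size s)}) := [ffun i => nth 0 s (g i)].
have hinj : injective h.
  move=> g g' /ffunP gg'; apply/ffunP => i; apply/val_inj/eqP => /=.
  by rewrite -(@nth_uniq _ 0 s) ?undup_uniq //; have := gg' i; rewrite !ffunE => ->.
pose B := [seq h g | g : {ffun 'I_M -> 'I_(size s)}].
apply: (@le_trans _ _ (\sum_(f <- B) \prod_(i < M) F (f i))).
  apply: ler_sum_sub => //.
  - by rewrite map_inj_uniq ?enum_uniq.
  - move=> f fA; apply/mapP.
    have fs i : (index (f i) s < size s)%N by rewrite index_mem sP.
    exists [ffun i => Ordinal (fs i)]; first by rewrite mem_enum.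
    by apply/ffunP => i; rewrite !ffunE /= nth_index ?sP.
  - by move=> f; apply: prodr_ge0.
rewrite big_map big_enum /=.
under eq_bigr do under eq_bigr do rewrite ffunE.
rewrite -(bigA_distr_bigA (fun _ (j : 'I_(size s)) => F (nth 0 s j))) /=.
rewrite prodr_const card_ord; apply: lerXn2r; rewrite ?nnegrE ?sumr_ge0 //.
  by have := FC [::] isT; rewrite big_nil.
have := FC s (undup_uniq _).
by rewrite (big_nth 0) big_mkord.
Qed.

Lemma sum_geometric_le (R : realFieldType) (r : R) (n : nat) :
  0 <= r <= 1 / 2 -> \sum_(0 <= i < n) r ^+ i <= 2.
Proof.
(* The added remainder makes the induction work, because [r ^+ n + 2 * r ^+ n.+1 <= 2 * r ^+ n]. *)
move=> /andP[r0 r2]; suff: \sum_(0 <= i < n) r ^+ i + 2 * r ^+ n <= 2.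
  by apply: le_trans; rewrite lerDl mulr_ge0 // exprn_ge0.
elim: n => [|n IH]; first by rewrite big_nil expr0; lra.
rewrite big_nat_recr //= exprS; have := exprn_ge0 n r0; nra.
Qed.

(** Each natural number is the cost of exactly two integers, so two geometric sums, each at most 2,
    bound the total. *)
Lemma sum_exp_cost_le (R : realFieldType) (r : R) (s : seq int) :
  0 <= r <= 1 / 2 -> uniq s -> \sum_(k <- s) r ^+ cost k <= 4.
Proof.
move=> r01 us; have r0 : 0 <= r by case/andP: r01.
pose n := (\max_(k <- s) cost k).+1.
pose s' := [seq Posz i | i <- iota 0 n] ++ [seq Negz i | i <- iota 0 n].
apply: (@le_trans _ _ (\sum_(k <- s') r ^+ cost k)).
  apply: ler_sum_sub => //.
  - rewrite cat_uniq; apply/and3P; split.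
    + by rewrite map_inj_uniq ?iota_uniq // => i j [].
    + by apply/hasPn => _ /mapP[i _ ->]; apply/mapP => -[].
    + by rewrite map_inj_uniq ?iota_uniq // => i j [].
  - move=> k ks; have kn : (cost k < n)%N by rewrite ltnS; apply: leq_bigmax_seq.
    rewrite mem_cat; apply/orP; case: k kn {ks} => k kn; [left|right].
      by apply: (map_f Posz); rewrite mem_iota.
    by apply: (map_f Negz); rewrite mem_iota.
  - by move=> k; apply: exprn_ge0.
rewrite big_cat !big_map /=.
have := sum_geometric_le n r01; rewrite /index_iota subn0; lra.
Qed.

(** The balance constraint does not involve [t], so one set serves a whole pass over the
    batteries. *)
Definition slice (M : nat) (T : nat) : set ({ffun 'I_M -> int} * int) :=
  [set x : {ffun 'I_M -> int} * int | x.2 + T%:Z + \sum_(m < M) x.1 m = 0].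

Arguments slice : clear implicits.

(** Keeping only the pairs that contain the drain suffices for summability: on a slice these
    differences determine [x]. *)
Lemma inv_cost_lineup0_ge (M : nat) (x : {ffun 'I_M -> int} * int) :
  (\sum_(i < M) cost (x.2 - x.1 i)%R <= inv_cost (lineup 0 x))%N.
Proof.
by rewrite lineup0 /= codomE big_map big_enum /= leq_addr.
Qed.

Lemma weight_summable (R : realType) (M T : nat) (r : R) : 0 <= r <= 1 / 2 ->
  (\esum_(x in slice M T) (r ^+ inv_cost (lineup 0 x))%:E < +oo)%E.
Proof.
move=> r01; have r0 : 0 <= r by case/andP: r01.
apply: (@le_lt_trans _ _ (4 ^+ M)%:E); last exact: ltry.
apply: ge_ereal_sup => _ [A [finA AT] <-].
rewrite fsbig_finite // sumEFin lee_fin.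
pose g (x : {ffun 'I_M -> int} * int) : {ffun 'I_M -> int} :=
  [ffun i => x.2 - x.1 i].
(* Equal differences leave only a common shift of all coordinates; the balance constraint makes
   [M + 1] times this shift vanish. *)
have ginj x y : slice M T x -> slice M T y -> g x = g y -> x = y.
  case: x y => [b d] [b' d'] /= xT yT /ffunP gg.
  have e i : b' i = b i + (d' - d) by have := gg i; rewrite !ffunE /=; lia.
  have dd : d' = d.
    move: yT xT; rewrite /slice /=; under eq_bigr do rewrite e.
    rewrite big_split /= sumr_const card_ord -mulr_natr natz.
    move: (\sum_(m < M) b m) => S yT xT.
    have /eqP : (d' - d) * (1 + M%:Z) = 0 by lia.
    by rewrite mulf_eq0 => /orP[] /eqP; lia.
  by congr pair => //; apply/ffunP => i; rewrite e dd; ring.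
apply: (@le_trans _ _
  (\sum_(f <- [seq g x | x <- finmap.enum_fset (fset_set A)])
     \prod_(i < M) r ^+ cost (f i))).
  rewrite big_map; apply: ler_sum => x _; under eq_bigr do rewrite ffunE.
  rewrite prodrXr; apply: ler_wiXn2l => //; first by lra.
  exact: inv_cost_lineup0_ge.
apply: (ler_sum_ffun_prod (F := fun k => r ^+ cost k)).
- by move=> k; apply: exprn_ge0.
- by move=> s; apply: sum_exp_cost_le.
- rewrite map_inj_in_uniq ?finmap.fset_uniq // => x y.
  by rewrite !in_fset_set // !inE => /AT xT /AT yT; apply: ginj.
Qed.

(** * Energy of subharmonic functions of a reversed swap *)

(** The nonnegative function [g - f] has sum zero; finiteness is what allows the sum of [f] to be
    cancelled. *)
Lemma eq_esum_le (R : realType) (T : choiceType) (A : set T) (f g : T -> R) :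
  (forall x, A x -> 0 <= f x <= g x) ->
  (\esum_(x in A) (g x)%:E < +oo)%E ->
  (\esum_(x in A) (g x)%:E <= \esum_(x in A) (f x)%:E)%E ->
  forall x, A x -> f x = g x.
Proof.
move=> fg goo gf x Ax.
have f0 y : A y -> (0 <= (f y)%:E)%E by move=> /fg /andP[? _]; rewrite lee_fin.
have h0 y : A y -> (0 <= (g y - f y)%:E)%E.
  by move=> /fg /andP[_ ?]; rewrite lee_fin subr_ge0.
have sumE : (\esum_(y in A) (g y)%:E =
    \esum_(y in A) (f y)%:E + \esum_(y in A) (g y - f y)%:E)%E.
  by rewrite -esumD //; apply: eq_esum => y _; rewrite -EFinD; congr EFin; ring.
have ffin : (\esum_(y in A) (f y)%:E)%E \is a fin_num.
  rewrite ge0_fin_numE ?esum_ge0 //; apply: le_lt_trans goo.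
  by apply: le_esum => y /fg /andP[_ ?]; rewrite lee_fin.
move: gf; rewrite sumE -[leRHS]adde0 leeD2lE // => s0.
have : ((g x - f x)%:E <= 0)%E.
  apply: le_trans s0; apply: esum_ge; exists [set x]%classic.
    by split; [exact: finite_set1|move=> y ->].
  by rewrite fsbig_set1.
by rewrite lee_fin; have /andP[_] := fg _ Ax; lra.
Qed.

Section ReversedSwap.
Context (R : realType) (T : choiceType) (A : set T) (s : T -> T) (L : pred T).
Context (r : R) (p p' : T -> R).
Hypotheses (r_gt0 : 0 < r) (r_lt1 : r < 1).
Hypothesis sK : involutive s.
Hypothesis sA : forall x, A x -> A (s x).
Hypothesis Ls : forall x, L x -> ~~ L (s x).
Hypothesis sfix : forall x, ~~ L x -> ~~ L (s x) -> s x = x.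
Hypothesis p_gt0 : forall x, 0 < p x.
Hypothesis p'E : forall x, p' x = p (s x).
Hypothesis pL : forall x, L x -> p x = r * p (s x).

(* The transition operator of the time reversal, with respect to the weights
   [p], of the step that applies [s] with probability [1 - r] on the preimage
   of [L] under [s] and does nothing elsewhere. *)
Definition rev_avg (u : T -> R) (x : T) : R :=
  if L x then r * u x + (1 - r) * u (s x) else u x.

(** This is stationarity: the forward step carries the weight [p] to [p']. *)
Lemma esum_rev_avg (f : T -> R) : (forall x, 0 <= f x) ->
  \esum_(x in A) (p' x * rev_avg f x)%:E = \esum_(x in A) (p x * f x)%:E.
Proof.
move=> f0; have r1 : 0 < 1 - r by rewrite subr_gt0.
(* [c x] is the mass that [x] sends to [s x], and [e x] the mass that stays; [s] reindexes the
   moving part. *)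
pose c x := if L (s x) then (1 - r) * (p x * f x) else 0.
pose e x := if L (s x) then r * (p x * f x) else p x * f x.
have pf0 x : 0 <= p x * f x by rewrite mulr_ge0 // ltW.
have c0 x : 0 <= c x by rewrite /c; case: ifP => // _; rewrite mulr_ge0 // ltW.
have e0 x : 0 <= e x by rewrite /e; case: ifP => // _; rewrite mulr_ge0 // ltW.
have -> : \esum_(x in A) (p' x * rev_avg f x)%:E =
    \esum_(x in A) ((e x)%:E + (c (s x))%:E)%E.
  apply: eq_esum => x _; rewrite -EFinD; congr EFin.
  rewrite /e /c /rev_avg p'E sK; case: ifPn => Lx.
    by rewrite (negPf (Ls Lx)) (pL Lx); ring.
  case: ifPn => Lsx; first by rewrite (pL Lsx) sK; ring.
  by rewrite (sfix Lx Lsx) addr0.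
rewrite esumD; [|by move=> *; rewrite lee_fin..].
have <- : \esum_(x in A) (c x)%:E = \esum_(x in A) (c (s x))%:E.
  apply: (reindex_esum A A s); split.
  - by move=> x /sA.
  - by move=> x y _ _ /(congr1 s); rewrite !sK.
  - by move=> x Ax; exists (s x); [exact: sA|exact: sK].
rewrite -esumD; [|by move=> *; rewrite lee_fin..].
apply: eq_esum => x _; rewrite -EFinD; congr EFin; rewrite /e /c.
by case: ifP => _; ring.
Qed.

Variables u u' : T -> R.
Hypothesis u0 : forall x, 0 <= u x.
Hypothesis u'0 : forall x, 0 <= u' x.
Hypothesis u'u : forall x, A x -> u' x <= rev_avg u x.

Let energy_le x : A x ->
  0 <= p' x * u' x ^+ 2 <= p' x * rev_avg (fun y => u y ^+ 2) x.
Proof.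
move=> Ax; have p'x : 0 < p' x by rewrite p'E.
rewrite mulr_ge0 ?exprn_ge0 // ?(ltW p'x) //= ler_pM2l // /rev_avg.
have := u'u Ax; have := u'0 x; rewrite /rev_avg.
case: ifP => _ h0 h1; last by rewrite lerXn2r ?nnegrE.
apply: (@le_trans _ _ ((r * u x + (1 - r) * u (s x)) ^+ 2)).
  by rewrite lerXn2r ?nnegrE // (le_trans h0).
(* Jensen's inequality for the square of a two-point average: the defect is the variance. *)
rewrite -subr_ge0.
suff -> : r * u x ^+ 2 + (1 - r) * u (s x) ^+ 2 -
   (r * u x + (1 - r) * u (s x)) ^+ 2 = r * (1 - r) * (u x - u (s x)) ^+ 2.
  by rewrite mulr_ge0 ?sqr_ge0 // mulr_ge0 ?subr_ge0 // ltW.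
by ring.
Qed.

Lemma esum_energy_le :
  (\esum_(x in A) (p' x * u' x ^+ 2)%:E <= \esum_(x in A) (p x * u x ^+ 2)%:E)%E.
Proof.
rewrite -(@esum_rev_avg (fun y => u y ^+ 2)) => [|y]; last exact: exprn_ge0.
by apply: le_esum => x Ax; rewrite lee_fin; have /andP[] := energy_le Ax.
Qed.

Lemma esum_energy_eq :
  (\esum_(x in A) (p x * u x ^+ 2)%:E < +oo)%E ->
  (\esum_(x in A) (p x * u x ^+ 2)%:E <=
    \esum_(x in A) (p' x * u' x ^+ 2)%:E)%E ->
  forall x, A x -> u' x = u x /\ u (s x) = u x.
Proof.
rewrite -(@esum_rev_avg (fun y => u y ^+ 2)) => [oo le x Ax|y]; last exact: exprn_ge0.
have eqL y : A y -> u' y ^+ 2 = rev_avg (fun y => u y ^+ 2) y.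
  move=> Ay; have := eq_esum_le energy_le oo le Ay.
  by apply: mulfI; rewrite gt_eqF // p'E.
have usL y : A y -> L y -> u' y = u y /\ u (s y) = u y.
  move=> Ay Ly; have := u'u Ay; have := eqL _ Ay; rewrite /rev_avg Ly => e le'.
  have h0 := u'0 y; have h : u' y ^+ 2 <= (r * u y + (1 - r) * u (s y)) ^+ 2.
    by rewrite lerXn2r ?nnegrE // (le_trans h0).
  (* Equality of the energies forces the variance to vanish, and its factor [r * (1 - r)] is
     positive. *)
  have /eqP : (u y - u (s y)) ^+ 2 = 0.
    apply: le_anti; rewrite sqr_ge0 andbT.
    have rr : 0 < r * (1 - r) by rewrite mulr_gt0 ?subr_gt0.
    by rewrite -(ler_pM2l rr) mulr0; move: h; rewrite e; lra.
  rewrite sqrf_eq0 subr_eq0 => /eqP us; rewrite -us; split=> //.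
  move: e; rewrite -us => e; apply/eqP; rewrite -(@eqrXn2 _ 2) // e.
  by apply/eqP; ring.
have [Lx|Lx] := boolP (L x); first exact: usL.
have -> : u' x = u x.
  have := eqL _ Ax; rewrite /rev_avg (negPf Lx) => /eqP.
  by rewrite eqrXn2 // => /eqP.
(* Outside [L], either [s] fixes [x], or [s x] lies in [L] and the previous case applies there. *)
split=> //; have [Lsx|Lsx] := boolP (L (s x)); last by rewrite (sfix Lx Lsx).
by have [_] := usL _ (sA Ax) Lsx; rewrite sK.
Qed.

End ReversedSwap.

(** * Upper limits of bounded real sequences *)

Section Limsup.
Variable R : realType.
Implicit Types a : nat -> R.

Definition limsup a : R := fine (limn_esup (EFin \o a)).

Lemma limn_esup_le a (N : nat) (l : R) : (forall n, (N <= n)%N -> a n <= l) ->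
  (limn_esup (EFin \o a) <= l%:E)%E.
Proof.
move=> al; apply: (@le_trans _ _
  (ereal_sup ((EFin \o a) @` [set n | (N <= n)%N]%classic))).
  by apply: ereal_inf_lbound; exists [set n | (N <= n)%N]%classic => //; exists N => //=.
by apply: ge_ereal_sup => _ [n /= Nn <-]; rewrite lee_fin al.
Qed.

Lemma limn_esup_ge a (l : R) : (forall n, l <= a n) ->
  (l%:E <= limn_esup (EFin \o a))%E.
Proof.
move=> la; apply: le_ereal_inf_tmp => _ [V [N _ NV] <-].
apply: (@le_trans _ _ (a N)%:E); first by rewrite lee_fin.
by apply: ereal_sup_ubound; exists N => //; apply: NV => /=.
Qed.

Variable C : R.

Lemma limsupE a : (forall n, 0 <= a n <= C) ->
  limn_esup (EFin \o a) = (limsup a)%:E.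
Proof.
move=> a0C; rewrite /limsup fineK // fin_real //.
apply/andP; split.
  apply: (@lt_le_trans _ _ 0%:E); first exact: ltNyr.
  by apply: limn_esup_ge => n; case/andP: (a0C n).
apply: (@le_lt_trans _ _ C%:E); last exact: ltry.
by apply: (@limn_esup_le _ 0) => n _; case/andP: (a0C n).
Qed.

Lemma limsup_ge0 a : (forall n, 0 <= a n <= C) -> 0 <= limsup a.
Proof.
move=> a0C; rewrite -lee_fin -limsupE // limn_esup_ge // => n.
by case/andP: (a0C n).
Qed.

Lemma limsup_le a (N : nat) (l : R) : (forall n, 0 <= a n <= C) ->
  (forall n, (N <= n)%N -> a n <= l) -> limsup a <= l.
Proof. by move=> a0C /limn_esup_le; rewrite limsupE // lee_fin. Qed.

Lemma lt_limsup a (l : R) : (forall n, 0 <= a n <= C) -> limsup a < l ->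
  exists N, forall n, (N <= n)%N -> a n <= l.
Proof.
move=> a0C; rewrite -lte_fin -limsupE // => /ereal_inf_lt[_ [V [N _ NV] <-]] Vl.
exists N => n Nn; rewrite -lee_fin; apply: le_trans (ltW Vl).
by apply: ereal_sup_ubound; exists n => //; apply: NV.
Qed.

(** Only an inequality can be expected, as [a] and [b] may approach their upper limits along
    different indices. *)
Lemma limsup_comb a b c (x y : R) :
  (forall n, 0 <= a n <= C) -> (forall n, 0 <= b n <= C) ->
  (forall n, 0 <= c n <= C) -> 0 <= x -> 0 <= y ->
  (forall n, c n.+1 = x * a n + y * b n) ->
  limsup c <= x * limsup a + y * limsup b.
Proof.
move=> a0C b0C c0C x0 y0 cE; apply/ler_addgt0Pr => e e0.
(* The total error is [(x + y) * d <= e]; the 1 keeps the denominator positive. *)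
pose d := e / (x + y + 1).
have xy : 0 < x + y + 1 by lra.
have d0 : 0 < d by rewrite divr_gt0.
have [N1 H1] := @lt_limsup a (limsup a + d) a0C ltac:(lra).
have [N2 H2] := @lt_limsup b (limsup b + d) b0C ltac:(lra).
apply: (limsup_le (N := (N1 + N2).+1)) => // -[//|n] Nn; rewrite cE.
have h1 : x * a n <= x * (limsup a + d) by rewrite ler_wpM2l // H1; lia.
have h2 : y * b n <= y * (limsup b + d) by rewrite ler_wpM2l // H2; lia.
have de : d * (x + y + 1) = e by rewrite mulfVK // gt_eqF.
by nra.
Qed.

(** With a single term the inequality of [limsup_comb] becomes an equality, so nothing is lost when
    [T] changes. *)
Lemma limsup_shift a c :
  (forall n, 0 <= a n <= C) -> (forall n, 0 <= c n <= C) ->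
  (forall n, c n.+1 = a n) -> limsup c = limsup a.
Proof.
move=> a0C c0C ca; apply: le_anti; apply/andP; split.
  apply: le_trans (@limsup_comb a a c 1 0 _ _ _ _ _ _) _ => //.
    by move=> n; rewrite ca mul1r mul0r addr0.
  by rewrite mul1r mul0r addr0.
apply/ler_addgt0Pr => e e0.
have [N H] := @lt_limsup c (limsup c + e) c0C ltac:(lra).
by apply: (limsup_le (N := N)) => // n Nn; rewrite -ca H // ltnW.
Qed.

End Limsup.

(** * The battery-discharge chain *)

Section Slices.
Variable M : nat.
Implicit Type x : {ffun 'I_M -> int} * int.

Lemma sum_xch (i : 'I_M) x :
  \sum_(m < M) (xch i x).1 m + (xch i x).2 = \sum_(m < M) x.1 m + x.2.
Proof.
rewrite (bigD1 i) //= [in RHS](bigD1 i) //= ffunE eqxx.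
under eq_bigr => m mi do rewrite ffunE (negPf mi).
by ring.
Qed.

Lemma sliceP (T : nat) x :
  slice M T x <-> x.2 + T%:Z + \sum_(m < M) x.1 m = 0.
Proof. by []. Qed.

Lemma slice_xch (T : nat) (i : 'I_M) x : slice M T x -> slice M T (xch i x).
Proof.
move/sliceP => xT; apply/sliceP; have := sum_xch i x.
by move: (\sum_(m < M) x.1 m) xT (\sum_(m < M) _); lia.
Qed.

Definition drain x : {ffun 'I_M -> int} * int := (x.1, x.2 - 1).

Definition charge x : {ffun 'I_M -> int} * int := ([ffun m => x.1 m + 1], x.2).

Lemma drain_inj : injective drain.
Proof. by move=> [b d] [b' d'] [-> /addIr ->]. Qed.

Lemma charge_inj : injective charge.
Proof.
move=> [b d] [b' d'] [/ffunP bb' ->]; congr pair; apply/ffunP => m.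
by have := bb' m; rewrite !ffunE => /addIr.
Qed.

Definition undrain x : {ffun 'I_M -> int} * int := (x.1, x.2 + 1).

Definition uncharge x : {ffun 'I_M -> int} * int := ([ffun m => x.1 m - 1], x.2).

Lemma undrainK : cancel undrain drain.
Proof. by move=> [b d]; rewrite /drain addrK. Qed.

Lemma unchargeK : cancel uncharge charge.
Proof.
by move=> [b d]; congr pair; apply/ffunP => m; rewrite !ffunE subrK.
Qed.

Lemma sum_charge x : \sum_(m < M) (charge x).1 m = \sum_(m < M) x.1 m + M%:Z.
Proof.
under eq_bigr do rewrite ffunE.
by rewrite big_split /= sumr_const card_ord natz.
Qed.

Lemma drain_bij (T : nat) : set_bij (slice M T) (slice M T.+1) drain.
Proof.
split.
- by move=> x /sliceP xT; apply/sliceP; rewrite -[RHS]xT /=; lia.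
- by move=> x y _ _; apply: drain_inj.
- move=> x /sliceP xT; exists (undrain x); last exact: undrainK.
  by apply/sliceP; rewrite -[RHS]xT /=; lia.
Qed.

Lemma charge_bij : set_bij (slice M M) (slice M 0) charge.
Proof.
split.
- move=> x /sliceP xT; apply/sliceP; rewrite sum_charge -[RHS]xT.
  by move: (\sum_(m < M) _) => S /=; lia.
- by move=> x y _ _; apply: charge_inj.
- move=> x /sliceP xT; exists (uncharge x); last exact: unchargeK.
  apply/sliceP; have := sum_charge (uncharge x); rewrite unchargeK.
  move: xT; move: (\sum_(m < M) x.1 m) (\sum_(m < M) _) => S S' /=; lia.
Qed.

End Slices.

Section Chain.
Variables (R : realType) (M q : nat).
Hypothesis q_ge2 : (2 <= q)%N.
Implicit Type x : {ffun 'I_M -> int} * int.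

Let r : R := q%:R^-1.

Let q_gt0 : (0 : R) < q%:R. Proof. by rewrite ltr0n; lia. Qed.
Let r_gt0 : 0 < r. Proof. by rewrite invr_gt0. Qed.
Let r_le2 : r <= 1 / 2.
Proof. by rewrite /r div1r lef_pV2 ?posrE // ler_nat. Qed.
Let r_lt1 : r < 1. Proof. by have := r_le2; lra. Qed.

(* The stationary weight [q ^- K] of the paper, [K] being the class of the
   state; the index [t] is zero-based. *)
Definition wt (t : nat) x : R := r ^+ inv_cost (lineup t x).

Lemma wt_gt0 t x : 0 < wt t x. Proof. exact: exprn_gt0. Qed.

Lemma wt_le1 t x : wt t x <= 1.
Proof. by rewrite exprn_ile1 // ltW. Qed.

Lemma wt_xch (i : 'I_M) x : wt i.+1 x = wt i (xch i x).
Proof. by rewrite /wt lineup_xch. Qed.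

(** Only the drain and battery [i] change their relative order, and the larger entry [x.2] comes
    first in [lineup i x]. *)
Lemma wt_lt (i : 'I_M) x : x.1 i < x.2 -> wt i x = r * wt i (xch i x).
Proof.
move=> lt; rewrite -wt_xch /wt -exprS; congr (_ ^+ _).
have := inv_cost_swap (take i (codom x.1)) (drop i.+1 (codom x.1)) x.2 (x.1 i).
rewrite -lineupE -lineupSE.
by rewrite (@costS (x.2 - x.1 i) (x.1 i - x.2)); lia.
Qed.

Lemma wt_drain x : wt 0 (drain x) = wt M x.
Proof. by rewrite /wt lineupM lineup0 inv_cost_rotate_down. Qed.

(** The lineup of [charge x] is that of [drain x] with 1 added to every entry, and costs depend on
    differences only. *)
Lemma wt_charge x : wt 0 (charge x) = wt M x.
Proof.
rewrite -wt_drain /wt !lineup0 -(inv_cost_map_addr (_ :: codom (drain x).1) 1).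
congr (_ ^+ inv_cost _); rewrite /= subrK; congr cons.
rewrite /codom /image_mem -map_comp; apply: eq_map => m /=.
by rewrite ffunE.
Qed.

(** * Transition probabilities and the recursion for [mu] *)

Lemma step_compare (i : 'I_M) x (T : int) :
  step R q (x, T, i.+1) =
  if x.2 < x.1 i then [:: ((xch i x, T, i.+2), 1 - r); ((x, T, i.+2), r)]
  else [:: ((x, T, i.+2), 1)].
Proof.
case: x => b d; rewrite /step ltn_ord.
have -> : b_at b i.+1 = b i.
  rewrite /b_at (bigD1 i) //= big1 ?addr0 // => m /andP[].
  by rewrite eqSS val_eqE => ->.
have -> : [ffun m : 'I_M => if m.+1 == i.+1 then d else b m] = (xch i (b, d)).1.
  by apply/ffunP => m; rewrite !ffunE eqSS val_eqE.
by rewrite /r mulrBl divff ?gt_eqF // !div1r.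
Qed.

Lemma step_drain x (T : nat) : (T < M)%N ->
  step R q (x, T%:Z, M.+1) = [:: ((drain x, T.+1%:Z, 1%N), 1)].
Proof.
have -> : T.+1%:Z = T%:Z + 1 by lia.
by case: x => b d TM; rewrite /step ltnn ltz_nat TM.
Qed.

Lemma step_charge x :
  step R q (x, M%:Z, M.+1) = [:: ((charge x, 0, 1%N), 1)].
Proof. by case: x => b d; rewrite /step ltnn ltxx. Qed.

Lemma in_SP (s : bdm_state M) : in_S s <->
  exists x, exists2 T : nat, (T <= M)%N /\ slice M T x &
  (exists i : 'I_M, s = (x, T%:Z, i.+1)) \/ s = (x, T%:Z, M.+1).
Proof.
split; last first.
  move=> [x [T [TM xT] [[i ->]|->]]]; split=> //; split=> //=.
  by rewrite ltnW // ltnS.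
case: s => [[x T] t] [[]]; rewrite /st_t /st_T /= => /andP[t0 tM] xT /andP[T0 TM].
exists x; exists `|T|%N; first by split; [lia|rewrite /slice /= gez0_abs].
rewrite gez0_abs //; have [tM'|tM'] := ltnP t.-1 M; [left|right].
  by exists (Ordinal tM'); congr pair; rewrite /=; lia.
by congr pair; lia.
Qed.

Lemma step_in_S (s : bdm_state M) (p : bdm_state M * R) :
  in_S s -> p \in step R q s -> in_S p.1.
Proof.
have next x T (i : 'I_M) : (T <= M)%N -> slice M T x -> in_S (x, T%:Z, i.+2).
  move=> TM xT; apply/in_SP; exists x; exists T => //.
  have [iM|iM] := ltnP i.+1 M; first by left; exists (Ordinal iM).
  by right; congr pair; have := ltn_ord i; lia.
have first x T : (T <= M)%N -> slice M T x -> in_S (x, T%:Z, 1%N).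
  move=> TM xT; apply/in_SP; exists x; exists T => //.
  have [M0|M0] := ltnP 0 M; first by left; exists (Ordinal M0).
  by right; congr pair; lia.
move=> /in_SP[x [T [TM xT] [[i ->]|->]]].
  rewrite step_compare; case: ifP => _; rewrite !inE.
    by move=> /orP[] /eqP -> /=; apply: next => //; apply: slice_xch.
  by move=> /eqP -> /=; apply: next.
have [TM'|MT] := ltnP T M.
  rewrite step_drain // inE => /eqP -> /=; apply: first => //.
  by have [] := @drain_bij M T => h _ _; exact: h.
have TME : T = M by lia.
rewrite TME step_charge inE => /eqP -> /=; apply: (first _ 0%N) => //.
by have [] := @charge_bij M => h _ _; apply: h; rewrite TME in xT.
Qed.

Lemma mu_list_in_S (n : nat) (p : bdm_state M * R) :
  p \in mu_list R M q n -> in_S p.1.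
Proof.
elim: n p => [|n IH] p /=.
  rewrite inE => /eqP -> /=; rewrite /in_S /in_Sbar /s0 /st_d /st_T /st_b /st_t /=.
  by split=> //; split; [lia|rewrite big1 // => m _; rewrite ffunE].
move=> /flattenP[_ /mapP[p' p'n ->] /mapP[p'' p''s ->]] /=.
by apply: step_in_S p''s; exact: IH.
Qed.

Lemma mu_succ (n : nat) (s : bdm_state M) :
  mu R q n.+1 s = \sum_(p <- mu_list R M q n) p.2 * trans_prob R q p.1 s.
Proof.
rewrite /mu /= big_flatten big_map; apply: eq_bigr => p _.
by rewrite big_map /trans_prob mulr_sumr.
Qed.

Lemma sum_mu_list (n : nat) (s : bdm_state M) :
  \sum_(p <- mu_list R M q n) p.2 * (p.1 == s)%:R = mu R q n s.
Proof.
by rewrite /mu [RHS]big_mkcond; apply: eq_bigr => p _; case: eqP; rewrite ?mulr1 ?mulr0.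
Qed.

Lemma trans_probE (s s' : bdm_state M) :
  trans_prob R q s s' = \sum_(p <- step R q s) p.2 * (p.1 == s')%:R.
Proof.
rewrite /trans_prob big_mkcond; apply: eq_bigr => p _.
by case: eqP; rewrite ?mulr1 ?mulr0.
Qed.

Lemma step_full_clock x (T : nat) (p : bdm_state M * R) : (T <= M)%N ->
  p \in step R q (x, T%:Z, M.+1) -> p.1.2 = 1%N.
Proof.
rewrite leq_eqVlt => /orP[/eqP ->|TM].
  by rewrite step_charge inE => /eqP ->.
by rewrite step_drain // inE => /eqP ->.
Qed.

Lemma step_compare_clock x (T : int) (i : 'I_M) (p : bdm_state M * R) :
  p \in step R q (x, T, i.+1) -> p.1.2 = i.+2.
Proof.
rewrite step_compare; case: ifP => _; rewrite !inE.
  by move=> /orP[] /eqP ->.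
by move=> /eqP ->.
Qed.

(** The clock after a step is determined by the source, which rules out every source with the wrong
    [t]. *)
Lemma trans_prob_clock (s s' : bdm_state M) :
  (forall p : bdm_state M * R, p \in step R q s -> p.1.2 != s'.2) ->
  trans_prob R q s s' = 0.
Proof.
move=> h; rewrite trans_probE big_seq big1 // => p /h ps.
have [e|_] := eqVneq p.1 s'; last by rewrite mulr0.
by rewrite e eqxx in ps.
Qed.

Lemma state_eqE x y (T T' : int) (t t' : nat) :
  ((x, T, t) == (y, T', t') :> bdm_state M) = [&& x == y, T == T' & t == t'].
Proof. by rewrite !xpair_eqE andbA. Qed.

(** The only predecessors are [x] and [xch i x]. The latter moves to [x] when its own battery [i]
    exceeds its drain, that is when [x.1 i < x.2]. *)
Lemma trans_prob_compare (s : bdm_state M) x (T : int) (i : 'I_M) : in_S s ->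
  trans_prob R q s (x, T, i.+2) =
  (if x.2 < x.1 i then r else 1) * (s == (x, T, i.+1))%:R +
  (if x.1 i < x.2 then 1 - r else 0) * (s == (xch i x, T, i.+1))%:R.
Proof.
move=> /in_SP[y [T' [TM _] [[j ->]|->]]]; last first.
  rewrite trans_prob_clock => [|p /(step_full_clock TM) -> //].
  have iM : (M.+1 == i.+1) = false by have := ltn_ord i; lia.
  by rewrite !state_eqE !iM !andbF !mulr0 addr0.
have [->{j}|ji] := eqVneq j i; last first.
  rewrite trans_prob_clock => [|p /step_compare_clock -> /=]; last first.
    by rewrite !eqSS val_eqE.
  by rewrite !state_eqE !eqSS val_eqE (negPf ji) !andbF !mulr0 addr0.
rewrite trans_probE step_compare !state_eqE !eqxx !andbT.
have [TT|TT] := eqVneq T'%:Z T; last first.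
  case: ifP => _; rewrite !big_cons big_nil !state_eqE /= (negPf TT).
    by rewrite !(andbF, andbT) /= !mulr0 !addr0.
  by rewrite !(andbF, andbT) /= !mulr0 !addr0.
rewrite !andbT; have [->{y}|yx] := eqVneq y x.
  case: ltP => xi; rewrite !big_cons big_nil !state_eqE /= TT !eqxx /=.
    have /negPf -> : xch i x != x.
      by apply/eqP => /(congr1 snd) /= e; rewrite e ltxx in xi.
    by rewrite (lt_gtF xi) mul0r mulr0 add0r !addr0.
  case: ltP => xi'; last by rewrite mul0r.
  have /negPf -> : x != xch i x.
    by apply/eqP => /(congr1 snd) /= e; rewrite -e ltxx in xi'.
  by rewrite mulr0.
have yxE : (y == xch i x) = (xch i y == x).
  by apply/eqP/eqP => [->|<-]; rewrite xchK.
case: ltP => yi; rewrite !big_cons big_nil !state_eqE /= TT !eqxx /= !andbT;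
  rewrite (negPf yx) !mulr0 !add0r ?addr0 yxE.
  have [<-|_] := eqVneq (xch i y) x; last by rewrite !mulr0.
  by rewrite /= ffunE eqxx yi.
have [<-|_] := eqVneq (xch i y) x; last by rewrite !mulr0.
by rewrite /= ffunE eqxx ltNge yi mul0r.
Qed.

Lemma trans_prob_drain (s : bdm_state M) x (T : nat) : in_S s -> (T < M)%N ->
  trans_prob R q s (drain x, T.+1%:Z, 1%N) = (s == (x, T%:Z, M.+1))%:R.
Proof.
move=> /in_SP[y [T' [TM' _] [[j ->]|->]]] TM.
  rewrite trans_prob_clock => [|p /step_compare_clock -> //].
  have jM : (j.+1 == M.+1) = false by have := ltn_ord j; lia.
  by rewrite !state_eqE jM !andbF.
rewrite trans_probE; have [T'M|T'M] := ltnP T' M.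
  rewrite step_drain // big_seq1 mul1r !state_eqE !eqxx !andbT.
  by rewrite (inj_eq (@drain_inj M)) !eqz_nat eqSS.
have -> : T' = M by lia.
by rewrite step_charge big_seq1 mul1r !state_eqE !eqz_nat (gtn_eqF TM) !andbF.
Qed.

Lemma trans_prob_charge (s : bdm_state M) x : in_S s ->
  trans_prob R q s (charge x, 0, 1%N) = (s == (x, M%:Z, M.+1))%:R.
Proof.
move=> /in_SP[y [T' [TM' _] [[j ->]|->]]].
  rewrite trans_prob_clock => [|p /step_compare_clock -> //].
  have jM : (j.+1 == M.+1) = false by have := ltn_ord j; lia.
  by rewrite !state_eqE jM !andbF.
rewrite trans_probE; have [T'M|T'M] := ltnP T' M.
  by rewrite step_drain // big_seq1 mul1r !state_eqE !eqz_nat (ltn_eqF T'M) !andbF.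
have -> : T' = M by lia.
by rewrite step_charge big_seq1 mul1r !state_eqE !eqxx !andbT (inj_eq (@charge_inj M)).
Qed.

Lemma mu_compare (n : nat) x (T : int) (i : 'I_M) :
  mu R q n.+1 (x, T, i.+2) =
  (if x.2 < x.1 i then r else 1) * mu R q n (x, T, i.+1) +
  (if x.1 i < x.2 then 1 - r else 0) * mu R q n (xch i x, T, i.+1).
Proof.
rewrite mu_succ -!sum_mu_list !mulr_sumr -big_split /=.
rewrite big_seq [RHS]big_seq; apply: eq_bigr => p /mu_list_in_S pS.
by rewrite trans_prob_compare // mulrDr; congr (_ + _); rewrite mulrCA.
Qed.

Lemma mu_drain (n : nat) x (T : nat) : (T < M)%N ->
  mu R q n.+1 (drain x, T.+1%:Z, 1%N) = mu R q n (x, T%:Z, M.+1).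
Proof.
move=> TM; rewrite mu_succ -sum_mu_list big_seq [RHS]big_seq.
by apply: eq_bigr => p /mu_list_in_S pS; rewrite trans_prob_drain.
Qed.

Lemma mu_charge (n : nat) x :
  mu R q n.+1 (charge x, 0, 1%N) = mu R q n (x, M%:Z, M.+1).
Proof.
rewrite mu_succ -sum_mu_list big_seq [RHS]big_seq.
by apply: eq_bigr => p /mu_list_in_S pS; rewrite trans_prob_charge.
Qed.

Lemma xch_fix (i : 'I_M) x : ~~ (x.1 i < x.2) ->
  ~~ ((xch i x).1 i < (xch i x).2) -> xch i x = x.
Proof.
case: x => b d /=; rewrite ffunE eqxx -!leNgt => bd db.
have e : b i = d by apply: le_anti; rewrite bd db.
rewrite /xch /= e; congr pair; apply/ffunP => m.
by rewrite ffunE; case: eqP => // ->.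
Qed.

Lemma xch_lt (i : 'I_M) x : ((xch i x).1 i < (xch i x).2) = (x.2 < x.1 i).
Proof. by rewrite /= ffunE eqxx. Qed.

(** * Domination by the stationary weight, and the limiting density *)

Lemma mu_init (s : bdm_state M) : mu R q 0 s = (s0 M == s)%:R.
Proof. by rewrite /mu /= big_mkcond big_seq1 /=; case: eqP. Qed.

Lemma wt_s0 : wt M ([ffun=> 0], 0) = 1.
Proof.
rewrite /wt lineupM.
suff -> : inv_cost (rcons (codom [ffun _ : 'I_M => 0 : int]) 0) = 0%N.
  by rewrite expr0.
have : all (eq_op^~ 0) (rcons (codom [ffun _ : 'I_M => 0 : int]) 0).
  rewrite all_rcons eqxx /=; apply/allP => _ /codomP[m ->].
  by rewrite ffunE.
elim: (rcons _ _) => //= a s IH /andP[/eqP -> s0]; rewrite IH // addn0.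
rewrite big_seq big1 // => b bs.
by have /allP/(_ _ bs)/eqP -> := s0.
Qed.

(** Induction on time, for all [T] and [t] at once; the constant is 1 because [s0] has weight 1. *)
Lemma mu_bound (n : nat) x (T t : nat) : (T <= M)%N -> (t <= M)%N ->
  0 <= mu R q n (x, T%:Z, t.+1) <= wt t x.
Proof.
elim: n x T t => [|n IH] x T t TM tM.
  rewrite mu_init ler0n /=; case: eqP => [[<- _ <-]|_]; last exact/ltW/wt_gt0.
  by rewrite wt_s0.
case: t tM => [|t] tM.
  case: T TM => [|T] TM.
    by rewrite -(unchargeK x) mu_charge wt_charge; apply: IH.
  by rewrite -(undrainK x) mu_drain // wt_drain; apply: IH => //; exact: ltnW.
have := mu_compare n x T%:Z (Ordinal tM); rewrite /= => ->.
set i := Ordinal tM.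
have /andP[a0 aw] := IH x T t TM (ltnW tM).
have /andP[b0 bw] := IH (xch i x) T t TM (ltnW tM).
have -> : wt t.+1 x = wt t (xch i x) by rewrite -(wt_xch i).
(* In each case the recursion, applied to the weights instead of [mu], reproduces the weight at the
   next clock value exactly. *)
have [lt|gt|eq] := ltgtP (x.1 i) x.2.
- have := @wt_lt i x lt; rewrite /= => e; rewrite e in aw.
  have := r_gt0; have := r_lt1; nra.
- have := @wt_lt i (xch i x); rewrite xch_lt xchK => /(_ gt) /= ->.
  have := r_gt0; nra.
- have -> : xch i x = x by rewrite xch_fix ?xch_lt ?eq ?ltxx.
  by nra.
Qed.

(** The density of [mu_inf] with respect to the weight; [t] is zero-based here, hence [t.+1]. *)
Definition ratio (T t : nat) x : R :=
  limsup (fun n => mu R q n (x, T%:Z, t.+1)) / wt t x.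

Lemma mu_le1 (n : nat) x (T t : nat) : (T <= M)%N -> (t <= M)%N ->
  0 <= mu R q n (x, T%:Z, t.+1) <= 1.
Proof.
move=> TM tM; have /andP[-> /= /le_trans] := mu_bound n x TM tM; apply.
exact: wt_le1.
Qed.

Lemma ratio_bound (T t : nat) x : (T <= M)%N -> (t <= M)%N ->
  0 <= ratio T t x <= 1.
Proof.
move=> TM tM; rewrite divr_ge0 ?(ltW (wt_gt0 _ _)) //=; last first.
  by apply: (@limsup_ge0 _ 1) => n; apply: mu_le1.
rewrite ler_pdivrMr ?wt_gt0 // mul1r.
apply: (@limsup_le _ 1 _ 0) => n; first exact: mu_le1.
by move=> _; have /andP[] := mu_bound n x TM tM.
Qed.

Lemma mu_infE (T t : nat) x : (T <= M)%N -> (t <= M)%N ->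
  mu_inf R q (x, T%:Z, t.+1) = (wt t x * ratio T t x)%:E.
Proof.
move=> TM tM; rewrite /ratio mulrC mulfVK ?gt_eqF ?wt_gt0 //.
by apply: (@limsupE _ 1) => n; apply: mu_le1.
Qed.

Lemma ratio_drain (T : nat) x : (T < M)%N -> ratio T.+1 0 (drain x) = ratio T M x.
Proof.
move=> TM; rewrite /ratio wt_drain; congr (_ / _).
apply: (@limsup_shift _ 1) => n; [by apply: mu_le1 => //; exact: ltnW|exact: mu_le1|].
exact: mu_drain.
Qed.

Lemma ratio_charge x : ratio 0 0 (charge x) = ratio M M x.
Proof.
rewrite /ratio wt_charge; congr (_ / _).
apply: (@limsup_shift _ 1) => n; [exact: mu_le1|exact: mu_le1|].
exact: mu_charge.
Qed.

(** Taking upper limits in [mu_compare] gives an inequality; dividing by the weights turns its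
    coefficients into those of the time reversal. *)
Lemma ratio_compare (T : nat) (i : 'I_M) x : (T <= M)%N ->
  ratio T i.+1 x <=
  rev_avg (xch i) (fun x => x.1 i < x.2) r (ratio T i) x.
Proof.
move=> TM; have iM : (i <= M)%N by exact: ltnW.
rewrite /ratio /rev_avg; set la := limsup _; set lb := limsup _; set lc := limsup _.
have := @limsup_comb R 1 _ _ _ (if x.2 < x.1 i then r else 1)
  (if x.1 i < x.2 then 1 - r else 0)
  (fun n => mu_le1 n x TM iM) (fun n => mu_le1 n (xch i x) TM iM)
  (fun n => mu_le1 n x TM (ltn_ord i : i.+1 <= M)%N) _ _ (fun n => mu_compare n x T%:Z i).
rewrite -/la -/lb -/lc.
have -> : 0 <= (if x.2 < x.1 i then r else 1) by case: ifP => _ //; rewrite ltW.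
have -> : 0 <= (if x.1 i < x.2 then 1 - r else 0).
  by case: ifP => _ //; rewrite subr_ge0 ltW.
move=> /(_ isT isT); rewrite wt_xch.
have w0 := wt_gt0 i (xch i x); have w1 := wt_gt0 i x.
have [lt|gt|eq] := ltgtP (x.1 i) x.2.
- rewrite (wt_lt lt) ler_pdivrMr // mul1r => /le_trans; apply.
  suff -> : (r * (lb / (r * wt i (xch i x))) + (1 - r) * (lc / wt i (xch i x)))
    * wt i (xch i x) = lb + (1 - r) * lc by [].
  by field; rewrite !gt_eqF.
- have := @wt_lt i (xch i x); rewrite xch_lt xchK => /(_ gt) ->.
  rewrite mul0r addr0 => h; rewrite ler_pdivrMr ?mulr_gt0 //.
  by apply: le_trans h _; rewrite mulrCA mulfVK // gt_eqF.
- have -> : xch i x = x by rewrite xch_fix ?xch_lt ?eq ?ltxx.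
  by rewrite mul1r mul0r addr0 => h; rewrite ler_pM2r // invr_gt0.
Qed.

(** * Constancy of the energy, and then of the density *)

Definition energy (T t : nat) : \bar R :=
  (\esum_(x in slice M T) (wt t x * ratio T t x ^+ 2)%:E)%E.

Let cmp (i : 'I_M) : pred ({ffun 'I_M -> int} * int) := fun x => x.1 i < x.2.

Let cmp_xch (i : 'I_M) x : cmp i x -> ~~ cmp i (xch i x).
Proof. by rewrite /cmp xch_lt -leNgt => /ltW. Qed.

Lemma energyS (T : nat) (i : 'I_M) : (T <= M)%N ->
  (energy T i.+1 <= energy T i)%E.
Proof.
move=> TM; apply: (@esum_energy_le _ _ _ (xch i) (cmp i) r).
- exact: r_gt0.
- exact: r_lt1.
- exact: xchK.
- by move=> x; apply: slice_xch.
- exact: cmp_xch.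
- exact: xch_fix.
- exact: wt_gt0.
- exact: wt_xch.
- exact: wt_lt.
- by move=> x; have /andP[] := ratio_bound x TM (ltnW (ltn_ord i)).
- by move=> x; have /andP[] := ratio_bound x TM (ltn_ord i).
- by move=> x _; apply: ratio_compare.
Qed.

Lemma energy_le0 (T t : nat) : (T <= M)%N -> (t <= M)%N ->
  (energy T t <= energy T 0)%E.
Proof.
move=> TM; elim: t => // t IH tM.
exact: le_trans (energyS (Ordinal tM) TM) (IH (ltnW tM)).
Qed.

Lemma energy_geM (T t : nat) : (T <= M)%N -> (t <= M)%N ->
  (energy T M <= energy T t)%E.
Proof.
(* Descending induction on [t], starting from [M]. *)
move=> TM tM; rewrite -(subKn tM); elim: (M - t)%N => [|k IH]; first by rewrite subn0.
have [kM|Mk] := ltnP k M; last first.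
  by move: IH; have -> : (M - k = M - k.+1)%N by lia.
have iM : (M - k.+1 < M)%N by lia.
apply: le_trans IH _; have := energyS (Ordinal iM) TM; rewrite /=.
by have -> : (M - k.+1).+1 = (M - k)%N by lia.
Qed.

Lemma energy_drain (T : nat) : (T < M)%N -> energy T.+1 0 = energy T M.
Proof.
move=> TM; rewrite /energy (reindex_esum _ _ _ _ (drain_bij M T)).
by apply: eq_esum => x _; rewrite wt_drain ratio_drain.
Qed.

Lemma energy_charge : energy 0 0 = energy M M.
Proof.
rewrite /energy (reindex_esum _ _ _ _ (charge_bij M)).
by apply: eq_esum => x _; rewrite wt_charge ratio_charge.
Qed.

Lemma energy_fin : (energy 0 0 < +oo)%E.
Proof.
have r01 : 0 <= r <= 1 / 2 by rewrite r_le2 ltW.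
apply: le_lt_trans (weight_summable M 0 r01); apply: le_esum => x _.
rewrite lee_fin ler_piMr ?(ltW (wt_gt0 _ _)) //.
have /andP[u0 u1] := @ratio_bound 0 0 x (leq0n M) (leq0n M).
by rewrite exprn_ile1.
Qed.

(** The energy decreases from [energy 0 0] through [energy T t] to [energy M M], and [energy_charge]
    closes the cycle. *)
Lemma energy_const (T t : nat) : (T <= M)%N -> (t <= M)%N ->
  energy T t = energy 0 0.
Proof.
have down k : (k <= M)%N -> (energy k 0 <= energy 0 0)%E.
  elim: k => [_|k IH kM]; first exact: lexx.
  rewrite (energy_drain kM).
  by apply: le_trans (IH (ltnW kM)); apply: energy_le0 => //; exact: ltnW.
have up k : (k <= M)%N -> (energy M M <= energy (M - k) M)%E.
  elim: k => [|k IH] kM; first by rewrite subn0.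
  apply: le_trans (IH (ltnW kM)) _.
  have <- : (M - k.+1).+1 = (M - k)%N by lia.
  rewrite -(@energy_drain (M - k.+1)); last by lia.
  by apply: energy_le0 => //; lia.
move=> TM tM; apply: le_anti; apply/andP; split.
  exact: le_trans (energy_le0 TM tM) (down T TM).
rewrite energy_charge; apply: le_trans (energy_geM TM tM).
by have := up (M - T)%N (leq_subr _ _); rewrite subKn.
Qed.

(** The energies before and after the comparison are equal and finite, so the equality case of
    Jensen's inequality applies. *)
Lemma ratio_xch (T : nat) (i : 'I_M) x : (T <= M)%N -> slice M T x ->
  ratio T i.+1 x = ratio T i x /\ ratio T i (xch i x) = ratio T i x.
Proof.
move=> TM; have iM : (i <= M)%N := ltnW (ltn_ord i).
apply: (@esum_energy_eq _ _ _ (xch i) (cmp i) r (wt i) (wt i.+1)).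
- exact: r_gt0.
- exact: r_lt1.
- exact: xchK.
- by move=> y; apply: slice_xch.
- exact: cmp_xch.
- exact: xch_fix.
- exact: wt_gt0.
- exact: wt_xch.
- exact: wt_lt.
- by move=> y; have /andP[] := ratio_bound y TM iM.
- by move=> y; have /andP[] := ratio_bound y TM (ltn_ord i).
- by move=> y _; apply: ratio_compare.
- by rewrite -/(energy T i) energy_const // energy_fin.
- by rewrite -/(energy T i) -/(energy T i.+1) !energy_const // ltn_ord.
Qed.

Lemma ratio_time (T t : nat) x : (T <= M)%N -> (t <= M)%N -> slice M T x ->
  ratio T t x = ratio T 0 x.
Proof.
move=> TM tM xT; elim: t tM => // t IH tM.
by have [/= -> _] := ratio_xch (Ordinal tM) TM xT; exact: IH (ltnW tM).
Qed.

Lemma ratio0_xch (T : nat) (i : 'I_M) x : (T <= M)%N -> slice M T x ->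
  ratio T 0 (xch i x) = ratio T 0 x.
Proof.
move=> TM xT; have iM : (i <= M)%N := ltnW (ltn_ord i).
rewrite -(ratio_time TM iM xT) -(ratio_time TM iM (slice_xch i xT)).
by have [] := ratio_xch i TM xT.
Qed.

(* Every step lowers one coordinate of [x] above the floor [m], except that
   coordinates and floor are shifted up by one whenever [T] wraps around. *)
Lemma ratio_descent (n : nat) (T : nat) x (m : int) : (T <= M)%N -> slice M T x ->
  (forall i, m <= x.1 i) -> m <= x.2 ->
  \sum_(i < M) x.1 i + x.2 = (M.+1)%:Z * m + n%:Z ->
  ratio T 0 x = ratio 0 0 ([ffun=> 0], 0).
Proof.
elim: n T x m => [|n IH] T x m TM xT mx1 mx2 sumE.
  (* With no excess over the floor, balance leaves a multiple of [M + 1] in the range from [-M] to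
     0, so [m] and [T] vanish. *)
  have mT : (M.+1)%:Z * m = - T%:Z.
    by move/sliceP: xT; move: sumE; move: (\sum_(i < M) x.1 i); lia.
  have m0 : m = 0 by nia.
  have T0 : T = 0%N by move: mT; rewrite m0; lia.
  have sum0 : \sum_(i < M) x.1 i + x.2 = 0 by rewrite sumE m0; lia.
  have pos i : 0 <= x.1 i by rewrite -m0.
  have s0 : 0 <= \sum_(i < M) x.1 i by apply: sumr_ge0.
  have x20 : x.2 = 0 by lia.
  have : \sum_(i < M) x.1 i = 0 by lia.
  move/eqP; rewrite psumr_eq0 // => /allP x10.
  rewrite T0; congr (ratio _ _ _).
  case: x x20 x10 {xT mx1 mx2 sumE sum0 pos s0} => b d /= -> b0.
  congr pair; apply/ffunP => i; rewrite ffunE; apply/eqP.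
  exact: (b0 i (mem_index_enum i)).
(* If the drain sits at the floor, the positive excess lies in some battery, which can be exchanged
   with the drain. *)
wlog x2 : x xT mx1 mx2 sumE / m < x.2.
  move=> wl; have [?|x2m] := ltP m x.2; first exact: wl.
  have [i xi] : exists i, m < x.1 i.
    apply/not_existsP => h; have : \sum_(i < M) x.1 i <= \sum_(i < M) m.
      by apply: ler_sum => i _; rewrite leNgt; apply/negP/h.
    rewrite sumr_const card_ord -mulr_natl natz; nia.
  rewrite -(ratio0_xch i) //; apply: wl => //.
  - exact: slice_xch.
  - by move=> j; rewrite /= ffunE; case: eqP.
  - exact: ltW.
  - by rewrite sum_xch.
have [TM'|MT] := ltnP T M.
  rewrite -(ratio_time TM (leqnn M) xT) -ratio_drain //.
  apply: (IH _ _ m) => //.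
  - by have [h _ _] := drain_bij M T; apply: h.
  - by rewrite /=; lia.
  - by rewrite /=; move: sumE; move: (\sum_(i < M) x.1 i); lia.
have TME : T = M by lia.
rewrite -(ratio_time TM (leqnn M) xT); rewrite TME in xT *; rewrite -ratio_charge.
(* The coordinates gain [M] in total and the floor term gains [M + 1], so the excess again drops by
   one. *)
apply: (IH _ _ (m + 1)) => //.
- by have [h _ _] := charge_bij M; apply: h.
- by move=> i; rewrite ffunE lerD2r.
- by rewrite /=; lia.
- by rewrite sum_charge /=; move: sumE; move: (\sum_(i < M) x.1 i); lia.
Qed.

Lemma ratio_const (T : nat) x : (T <= M)%N -> slice M T x ->
  ratio T M x = ratio 0 0 ([ffun=> 0], 0).
Proof.
move=> TM xT; rewrite (ratio_time TM (leqnn M) xT).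
pose B := (`|x.2| + \sum_(i < M) `|x.1 i|)%N.
have Bx i : (`|x.1 i| <= B)%N by rewrite /B (bigD1 i) //=; lia.
pose m := - B%:Z.
have mx1 i : m <= x.1 i by have := Bx i; lia.
have mx2 : m <= x.2 by rewrite /m /B; lia.
have s0 : 0 <= \sum_(i < M) (x.1 i - m) by apply: sumr_ge0 => i _; rewrite subr_ge0.
apply: (@ratio_descent (absz (\sum_(i < M) (x.1 i - m) + (x.2 - m))) _ _ m) => //.
rewrite gez0_abs; last by rewrite addr_ge0 // subr_ge0.
rewrite sumrB sumr_const card_ord -mulr_natl natz.
by move: (\sum_(i < M) x.1 i); lia.
Qed.

End Chain.

(** * The reflection symmetry *)

Lemma slice_refl (M T : nat) (x : {ffun 'I_M -> int} * int) : (T <= M)%N ->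
  slice M T x -> slice M (M - T) (refl x).
Proof.
move=> TM /sliceP xT; apply/sliceP => /=; under eq_bigr do rewrite ffunE.
have revE : \sum_(i < M) x.1 (rev_ord i) = \sum_(i < M) x.1 i.
  by rewrite [RHS](reindex_inj rev_ord_inj).
(* The constants -1 of the batteries sum to [-M], which cancels the [M] in [M - T]. *)
rewrite sumrB sumr_const card_ord revE.
by rewrite -mulr_natl natz; move: (\sum_(i < M) x.1 i) xT; lia.
Qed.

Theorem theorem14 (R : realType) (M q : nat) :
  (1 <= M)%N -> (2 <= q)%N ->
  forall (d : int) (T : nat), (T <= M)%N ->
    gamma R M q d T%:Z M.+1 = gamma R M q (- d) (M - T)%N%:Z M.+1.
Proof.
move=> _ q2 d T TM.
have inS y (T' : nat) : (T' <= M)%N ->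
    S_slice T'%:Z M.+1 y.2 (y, T'%:Z, M.+1) <-> slice M T' y.
  move=> TM'; split; first by case=> [[[_ h] _] _].
  move=> h; split=> //; split; last by rewrite /st_T /=; lia.
  by split=> //=; rewrite /st_t /= ltnSn.
(* The subtraction from [M] is taken in the integers, so [e] is an involution on all states and not
   only on slices. *)
pose e (s : bdm_state M) : bdm_state M := (refl s.1.1, M%:Z - s.1.2, s.2).
have eK : involutive e.
  by move=> [[x T'] t]; rewrite /e /= reflK; congr (_, _, _); ring.
have MT : (M - T)%N%:Z = M%:Z - T%:Z by lia.
have eS T' d' s : (T' <= M)%N -> S_slice T'%:Z M.+1 d' s ->
    S_slice (M - T')%N%:Z M.+1 (- d') (e s).
  move=> TM'; case: s => [[x T''] t] sS.
  have [_ [eT [et ed]]] := sS; move: eT et ed; rewrite /st_T /st_t /st_d /=.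
  move=> eT et ed; move: sS; rewrite eT et -ed /e /= => /inS - /(_ TM') xT.
  have -> : M%:Z - T'%:Z = (M - T')%N%:Z by lia.
  by apply/(inS (refl x)); [exact: leq_subr|exact: slice_refl].
rewrite /gamma [RHS](reindex_esum (S_slice T%:Z M.+1 d) _ e); last first.
  split.
  - by move=> s sS; apply: eS.
  - by move=> s s' _ _ /(congr1 e); rewrite !eK.
  - move=> s sS; exists (e s); last exact: eK.
    by have := eS _ _ _ (leq_subr _ _) sS; rewrite subKn // opprK.
apply: eq_esum => -[[x T'] t] sS.
have [_ [eT [et ed]]] := sS; move: eT et ed; rewrite /st_T /st_t /st_d /=.
move=> eT et ed; move: sS; rewrite eT et -ed /e /= => /inS - /(_ TM) xT.
(* Both densities equal the value at the zero state, so only the weights remain to be compared. *)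
rewrite -MT !mu_infE ?leq_subr // !ratio_const ?leq_subr //; last exact: slice_refl.
by rewrite /wt inv_cost_refl.
Qed.
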